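(* Let $F_0(u)$ be a polynomial with non-negative coefficients and let $Q=Q(\alpha_0,\alpha_1,z,u)$ be a polynomial in $\alpha_0,\alpha_1,z,u$ with non-negative coefficients that depends (at least) on $\alpha_1$, that is, $Q_{\alpha_1}\ne 0$. Let $M(z,u)$ be the power series solution of $$M(z,u) = F_0(u) + z\, Q\left(M(z,u), \frac{M(z,u)-M(z,0)}{u}, z, u\right).$$ Furthermore assume that $Q$ is not linear in $\alpha_0$ and $\alpha_1$, that is, $Q_{\alpha_0\alpha_0}\ne 0$ or $Q_{\alpha_0\alpha_1}\ne 0$ or $Q_{\alpha_1\alpha_1}\ne 0$. Let $f(z),u(z),w(z)$ be the power series solution of the system of equations $$f(z) = F_0(u(z)) + zQ(f(z),w(z),z,u(z)),$$ $$u(z) = z\,u(z)\,Q_{\alpha_0}(f(z),w(z),z,u(z)) + z\,Q_{\alpha_1}(f(z),w(z),z,u(z)),$$ $$w(z) = F_0'(u(z)) + z\,Q_u(f(z),w(z),z,u(z)) + z\,w(z)\,Q_{\alpha_0}(f(z),w(z),z,u(z)),$$ with $f(0)=F_0(0)$, $u(0)=0$, $w(0)=F_0'(0)$. Then $$M(z,0) = f(z)-w(z)u(z).$$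
   Context: Subscripts of $Q$ denote partial derivatives (e.g. $Q_{\alpha_0\alpha_1}=\partial^2Q/\partial\alpha_0\partial\alpha_1$), and conditions such as $Q_{\alpha_1}\neq 0$ mean that the derivative is not identically zero as a polynomial. The variable $u$ is called a catalytic variable. The functional equation has a unique power series solution $M(z,u)$ (a formal power series in $z$ whose coefficients are polynomials in $u$), and the system has a unique power series solution $(f,u,w)$ with the given initial values. *)

(* Defs.v *)
From HB Require Import structures.
From mathcomp Require Import all_boot all_order all_algebra.
From mathcomp Require Import boolp.
From mathcomp Require Import mpoly.

Set Implicit Arguments.
Unset Strict Implicit.
Unset Printing Implicit Defensive.

Import Order.TTheory GRing.Theory Num.Theory.

Local Open Scope ring_scope.

Record fps (A : Type) := FPS { fps_coef : nat -> A }.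
Coercion fps_coef : fps >-> Funclass.

HB.instance Definition _ (A : Type) := gen_eqMixin (fps A).
HB.instance Definition _ (A : Type) := gen_choiceMixin (fps A).

Definition fps_map (A B : Type) (h : A -> B) (f : fps A) : fps B :=
  FPS (fun n => h (f n)).

Lemma fpsP (A : Type) (f g : fps A) : (forall n, f n = g n) <-> f = g.
Proof.
split=> [|-> //]; case: f g => [f] [g] /= fg; congr FPS; exact: funext.
Qed.

Section FpsRing.
Variable A : comNzRingType.
Implicit Types f g h : fps A.

Definition fpsC (a : A) : fps A := FPS (fun n => if n == 0%N then a else 0).
Definition fpsX : fps A := FPS (fun n => (n == 1%N)%:R).

Definition fps_opp f : fps A := FPS (fun n => - f n).
Definition fps_add f g : fps A := FPS (fun n => f n + g n).
Definition fps_mul f g : fps A :=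
  FPS (fun n => \sum_(i < n.+1) f i * g (n - i)%N).

Fact fps_addA : associative fps_add.
Proof. by move=> f g h; apply/fpsP=> n /=; rewrite addrA. Qed.
Fact fps_addC : commutative fps_add.
Proof. by move=> f g; apply/fpsP=> n /=; rewrite addrC. Qed.
Fact fps_add0 : left_id (fpsC 0) fps_add.
Proof. by move=> f; apply/fpsP=> n /=; rewrite if_same add0r. Qed.
Fact fps_addN : left_inverse (fpsC 0) fps_opp fps_add.
Proof. by move=> f; apply/fpsP=> n /=; rewrite if_same addNr. Qed.

HB.instance Definition _ :=
  GRing.isZmodule.Build (fps A) fps_addA fps_addC fps_add0 fps_addN.

Definition fps_trunc N f : {poly A} := \poly_(i < N) f i.

Fact fps_trunc_mul N f g n : (n < N)%N ->
  fps_mul f g n = (fps_trunc N f * fps_trunc N g)`_n.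
Proof.
move=> ltnN; rewrite coefM /=; apply: eq_bigr => i _.
rewrite !coef_poly (leq_ltn_trans (leq_subr _ _) ltnN).
by rewrite (leq_trans (ltn_ord i) ltnN).
Qed.

Fact fps_trunc_coef N f i : (i < N)%N -> (fps_trunc N f)`_i = f i.
Proof. by move=> ltiN; rewrite coef_poly ltiN. Qed.

Fact fps_mulC : commutative fps_mul.
Proof.
by move=> f g; apply/fpsP=> n; rewrite !(@fps_trunc_mul n.+1) // mulrC.
Qed.

Fact fps_mulA : associative fps_mul.
Proof.
move=> f g h; apply/fpsP=> n; rewrite !(@fps_trunc_mul n.+1) //.
transitivity (fps_trunc n.+1 f * fps_trunc n.+1 g * fps_trunc n.+1 h)`_n.
  rewrite -mulrA !coefM; apply: eq_bigr => i _; congr (_ * _).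
  by rewrite fps_trunc_coef ?ltnS ?leq_subr // (@fps_trunc_mul n.+1) ?ltnS ?leq_subr.
rewrite !coefM; apply: eq_bigr => i _; congr (_ * _).
by rewrite fps_trunc_coef // (@fps_trunc_mul n.+1).
Qed.

Fact fps_mul1 : left_id (fpsC 1) fps_mul.
Proof.
move=> f; apply/fpsP=> n /=.
by rewrite big_ord_recl big1 ?addr0 ?mul1r ?subn0 // => i _; rewrite mul0r.
Qed.

Fact fps_mulDl : left_distributive fps_mul +%R.
Proof.
move=> f g h; apply/fpsP=> n /=.
by rewrite -big_split /=; apply: eq_bigr => i _; rewrite mulrDl.
Qed.

Fact fps_nonzero1 : fpsC 1 != 0.
Proof. by apply/eqP=> /fpsP /(_ 0%N) /eqP; rewrite /= oner_eq0. Qed.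

HB.instance Definition _ :=
  GRing.Zmodule_isComNzRing.Build (fps A)
    fps_mulA fps_mulC fps_mul1 fps_mulDl fps_nonzero1.

Fact fpsC_is_zmod_morphism : zmod_morphism fpsC.
Proof. by move=> a b; apply/fpsP=> -[|n] //=; rewrite subr0. Qed.

Fact fpsC_is_monoid_morphism : monoid_morphism fpsC.
Proof.
split=> // a b; apply/fpsP=> n /=; rewrite big_ord_recl /= subn0 big1 ?addr0.
  by case: n => //=; rewrite mulr0.
by move=> i _; rewrite mul0r.
Qed.

HB.instance Definition _ :=
  GRing.isZmodMorphism.Build A (fps A) fpsC fpsC_is_zmod_morphism.
HB.instance Definition _ :=
  GRing.isMonoidMorphism.Build A (fps A) fpsC fpsC_is_monoid_morphism.

End FpsRing.

Arguments fpsX {A}.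

(* Q : {mpoly R[4]} is read as Q(alpha_0, alpha_1, z, u), in this order. *)
Definition i_a0 : 'I_4 := @Ordinal 4 0 isT.
Definition i_a1 : 'I_4 := @Ordinal 4 1 isT.
Definition i_z : 'I_4 := @Ordinal 4 2 isT.
Definition i_u : 'I_4 := @Ordinal 4 3 isT.

Definition eval4 (R B : comNzRingType) (h : R -> B) (Q : {mpoly R[4]})
    (a0 a1 z u : B) : B :=
  mmap h (tnth [tuple a0; a1; z; u]) Q.

Section Catalytic.
Variable R : realFieldType.
Implicit Types Q : {mpoly R[4]}.

(* Elements of fps {poly R} are power series in z whose coefficients are
   polynomials in the catalytic variable u = 'X. *)

Definition at_u0 (M : fps {poly R}) : fps R := fps_map (fun p => p.[0]) M.

(* (M(z,u) - M(z,0)) / u; the coefficientwise division by 'X is exact, see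
   diff_quotE. *)
Definition diff_quot (M : fps {poly R}) : fps {poly R} :=
  fps_map (fun p => p %/ 'X) (M - fps_map polyC (at_u0 M)).

Lemma diff_quotE (M : fps {poly R}) :
  diff_quot M * fpsC 'X = M - fps_map polyC (at_u0 M).
Proof.
rewrite mulrC; apply/fpsP=> n.
have -> : (fpsC 'X * diff_quot M) n = 'X * (diff_quot M n).
  rewrite [LHS]big_ord_recl big1 ?addr0 ?subn0 // => i _.
  by rewrite /= mul0r.
rewrite mulrC divpK //.
have -> : (M - fps_map polyC (at_u0 M)) n = M n - ((M n).[0])%:P by [].
by rewrite -['X]subr0 -[0 : {poly R}]polyC0 dvdp_XsubCl rootE !hornerE subrr.
Qed.

Definition catalytic_eq (F0 : {poly R}) Q (M : fps {poly R}) : Prop :=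
  M = fpsC F0 +
      fpsX * eval4 (fun c => fpsC c%:P) Q M (diff_quot M) fpsX (fpsC 'X).

Definition horner_fps (P : {poly R}) (v : fps R) : fps R :=
  (map_poly (@fpsC R) P).[v].

Definition eval_fps Q (f w v : fps R) : fps R :=
  eval4 (@fpsC R) Q f w fpsX v.

Definition char_system (F0 : {poly R}) Q (f v w : fps R) : Prop :=
  [/\ f = horner_fps F0 v + fpsX * eval_fps Q f w v,
      v = fpsX * v * eval_fps Q^`M(i_a0) f w v + fpsX * eval_fps Q^`M(i_a1) f w v
    & w = horner_fps F0^`() v + fpsX * eval_fps Q^`M(i_u) f w v
          + fpsX * w * eval_fps Q^`M(i_a0) f w v].

End Catalytic.

(* Main.v *)
(* Substitute the given series u(z) for the catalytic variable, and compare
   f1 = M(z, u(z)) and w1 = D(z, u(z)), where D = (M(z,u) - M(z,0))/u, with f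
   and w. Differentiating the catalytic equation in u and using
   dM/du = D + u dD/du yields

     D + (dD/du) (u - z u Q_a0 - z Q_a1) = F0' + z Q_u + z D Q_a0.

   At u = u(z), the kernel in the second summand would vanish if the derivatives
   of Q were taken at (f, w) instead of (f1, w1); so it is z times an element of
   the ideal (f - f1, w - w1). Subtracting the equations of the system, f - f1
   and w - w1 both lie in z (f - f1, w - w1), hence are 0. Finally
   M(z,0) = M - u D becomes f - w u. *)

Require Import Defs.
From HB Require Import structures.
From mathcomp Require Import all_boot all_order all_algebra.
From mathcomp Require Import boolp.
From mathcomp Require Import mpoly ring.

Set Implicit Arguments.
Unset Strict Implicit.
Unset Printing Implicit Defensive.

Import Order.TTheory GRing.Theory Num.Theory.

Local Open Scope ring_scope.

(** * Evaluation of multivariate polynomials: chain rule and differences *)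

Lemma mpoly_alg_ind (n : nat) (R : comNzRingType) (P : {mpoly R[n]} -> Prop) :
    (forall c, P c%:MP) -> (forall i, P 'X_i) ->
    (forall p q, P p -> P q -> P (p + q)) ->
    (forall p q, P p -> P q -> P (p * q)) ->
  forall p, P p.
Proof.
move=> PC PX PD PM p; elim/mpolyind: p => [|c m p _ _ Pp].
  by rewrite -mpolyC0.
apply: (PD) => //; rewrite -mul_mpolyC; apply: (PM) => //.
rewrite mpolyXE_id; apply: big_ind => [||i _]; [by rewrite -mpolyC1 | exact: PM |].
by elim: (m i) => [|k IHk]; rewrite ?expr0 -?mpolyC1 // exprS; apply: PM.
Qed.

Section Mmap.
Variables (n : nat) (R B : comNzRingType) (h : {rmorphism R -> B}).
Implicit Types (t s : 'I_n -> B) (p : {mpoly R[n]}).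

(** Chain rule: both sides satisfy the Leibniz rule along [mmap h t] and vanish on constants, so it
    suffices to compare them on variables. *)
Lemma derivation_mmap (D : B -> B) t p :
    {morph D : x y / x + y} -> (forall x y, D (x * y) = D x * y + x * D y) ->
    (forall c, D (h c) = 0) ->
  D (mmap h t p) = \sum_i mmap h t p^`M(i) * D (t i).
Proof.
move=> DD DM Dh; elim/mpoly_alg_ind: p => [c|j|p q IHp IHq|p q IHp IHq].
- rewrite mmapC Dh big1 // => i _.
  by rewrite mderivC mmap0 mul0r.
- rewrite mmapX mmap1U (bigD1 j) //= big1 => [|i ij].
    have U0 : (U_(j) - U_(j))%MM = 0%MM :> 'X_{1..n}.
      by apply/mnmP => k; rewrite mnmBE mnm0E subnn.
    by rewrite mderivX mnm1E eqxx scale1r U0 mmapX mmap11 mul1r addr0.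
  by rewrite mderivX mnm1E eq_sym (negPf ij) scale0r mmap0 mul0r.
- rewrite mmapD DD IHp IHq -big_split; apply: eq_bigr => i _ /=.
  by rewrite mderivD mmapD mulrDl.
- rewrite rmorphM DM IHp IHq mulr_suml mulr_sumr -big_split.
  apply: eq_bigr => i _ /=; rewrite mderivM mmapD !rmorphM /=; ring.
Qed.

(** The difference lies in the ideal of the [t i - s i]: constants and variables are clear, and a
    product telescopes through p(s) q(t). *)
Lemma mmap_sub t s p :
  exists g : 'I_n -> B, mmap h t p - mmap h s p = \sum_i g i * (t i - s i).
Proof.
elim/mpoly_alg_ind: p => [c|j|p q [g gE] [k kE]|p q [g gE] [k kE]].
- by exists (fun=> 0); rewrite !mmapC subrr big1 // => i _; rewrite mul0r.
- exists (fun i => (i == j)%:R); rewrite !mmapX !mmap1U (bigD1 j) //= eqxx.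
  by rewrite mul1r big1 ?addr0 // => i /negPf ->; rewrite mul0r.
- exists (fun i => g i + k i); rewrite !mmapD opprD addrACA gE kE -big_split.
  by apply: eq_bigr => i _; rewrite mulrDl.
- exists (fun i => g i * mmap h t q + mmap h s p * k i); rewrite !rmorphM /=.
  transitivity ((mmap h t p - mmap h s p) * mmap h t q
                + mmap h s p * (mmap h t q - mmap h s q)); first by ring.
  rewrite gE kE mulr_suml mulr_sumr -big_split.
  by apply: eq_bigr => i _ /=; ring.
Qed.

Lemma rmorph_mmap (C : comNzRingType) (e : {rmorphism B -> C}) t p :
  e (mmap h t p) = mmap (e \o h) (e \o t) p.
Proof.
rewrite /mmap raddf_sum; apply: eq_bigr => m _; rewrite /= rmorphM /mmap1.
by rewrite rmorph_prod; congr (_ * _); apply: eq_bigr => i _; rewrite rmorphXn.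
Qed.

End Mmap.

(** * The four-variable case *)

Section Eval4.
Variables (R B : comNzRingType) (h : {rmorphism R -> B}).

Lemma derivation_eval4 (D : B -> B) Q a0 a1 z u :
    {morph D : x y / x + y} -> (forall x y, D (x * y) = D x * y + x * D y) ->
    (forall c, D (h c) = 0) -> D z = 0 -> D u = 1 ->
  D (eval4 h Q a0 a1 z u) =
    eval4 h Q^`M(i_a0) a0 a1 z u * D a0 + eval4 h Q^`M(i_a1) a0 a1 z u * D a1
    + eval4 h Q^`M(i_u) a0 a1 z u.
Proof.
move=> DD DM Dh Dz Du; rewrite [LHS]derivation_mmap //.
rewrite !big_ord_recl big_ord0 /=.
rewrite [D (tnth _ (lift _ (lift _ _)))]Dz mulr0 add0r.
rewrite [D (tnth _ (lift _ (lift _ (lift _ _))))]Du mulr1 addr0 !addrA /eval4.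
(* The indices produced by expanding the sum agree with [i_a0], [i_a1], [i_u] only by value. *)
by congr (_ + _ + _); congr (mmap _ _ _^`M(_) * _) || congr (mmap _ _ _^`M(_));
  apply: val_inj.
Qed.

Lemma eval4_sub Q a0 a1 b0 b1 z u : exists g : B * B,
  eval4 h Q a0 a1 z u - eval4 h Q b0 b1 z u
    = g.1 * (a0 - b0) + g.2 * (a1 - b1).
Proof.
have [g gE] :=
  mmap_sub h (tnth [tuple a0; a1; z; u]) (tnth [tuple b0; b1; z; u]) Q.
exists (g i_a0, g i_a1); rewrite [LHS]gE !big_ord_recl big_ord0 /=.
rewrite [tnth _ (lift _ (lift _ _)) - _]subrr.
rewrite [tnth _ (lift _ (lift _ (lift _ _))) - _]subrr !mulr0 !addr0.
by congr (g _ * _ + g _ * _); apply: val_inj.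
Qed.

Lemma rmorph_eval4 (C : comNzRingType) (e : {rmorphism B -> C}) Q a0 a1 z u :
  e (eval4 h Q a0 a1 z u) = eval4 (e \o h) Q (e a0) (e a1) (e z) (e u).
Proof.
rewrite [LHS]rmorph_mmap /eval4; congr mmap; apply: funext => i /=.
by case: i => -[|[|[|[|]]]].
Qed.

End Eval4.

(** * Coefficients of power series and a contraction principle *)

Section FpsTheory.
Variable A : comNzRingType.
Implicit Types f g : fps A.

Lemma coef_fpsM f g n : (f * g) n = \sum_(i < n.+1) f i * g (n - i)%N.
Proof. by []. Qed.

Lemma coef_fpsXM f n : (fpsX * f) n = if n is k.+1 then f k else 0.
Proof.
rewrite coef_fpsM; case: n => [|n].
  by rewrite big_ord_recl big_ord0 mul0r addr0.
rewrite !big_ord_recl mul0r add0r mul1r big1 ?addr0 ?subSS ?subn0 // => i _.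
by rewrite mul0r.
Qed.

Lemma coef_fpsXnM f k n :
  (fpsX ^+ k * f) n = if (n < k)%N then 0 else f (n - k)%N.
Proof.
elim: k n => [|k IHk] n; first by rewrite mul1r subn0.
by rewrite exprS -mulrA coef_fpsXM; case: n.
Qed.

Lemma coef_fps_sum (I : Type) (r : seq I) (F : I -> fps A) n :
  (\sum_(i <- r) F i) n = \sum_(i <- r) F i n.
Proof.
by elim/big_rec2: _ => [|i x y _ <-] //=; rewrite if_same.
Qed.

(** The factor z makes each coefficient of [a] and [b] depend only on earlier ones, so all vanish by
    strong induction. *)
Lemma linear_contraction_eq0 (p q r s a b : fps A) :
    a = fpsX * (p * a + q * b) -> b = fpsX * (r * a + s * b) ->
  a = 0 /\ b = 0.
Proof.
move=> aE bE.
have ab0 n : a n = 0 /\ b n = 0.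
  elim/ltn_ind: n => n IHn; rewrite {1}bE {1}aE !coef_fpsXM; case: n IHn => // n IHn.
  have coef0 x y : (x * a + y * b) n = 0.
    rewrite /= !big1 ?addr0 // => i _;
    have [a0 b0] := IHn (n - i)%N (leq_subr i n);
    by rewrite ?a0 ?b0 mulr0.
  by rewrite !coef0.
by split; apply/fpsP => n; have [an bn] := ab0 n; rewrite ?an ?bn /= if_same.
Qed.

End FpsTheory.

(** * Substituting a series in z for the catalytic variable *)

Section Substitution.
Variable R : fieldType.
Variable v : fps R.
Implicit Types M N : fps {poly R}.

Lemma comm_map_fpsC : commr_rmorph (@fpsC R) v.
Proof. by move=> c; apply: mulrC. Qed.

Definition poly_at : {poly R} -> fps R := horner_morph comm_map_fpsC.
HB.instance Definition _ := GRing.RMorphism.on poly_at.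

Lemma poly_atC c : poly_at c%:P = fpsC c.
Proof. exact: horner_morphC. Qed.

Lemma comm_map_poly_at : commr_rmorph poly_at (@fpsX R).
Proof. by move=> c; apply: mulrC. Qed.

(** The outer variable stands for z, the inner one for u: truncations of M(z,u) are such
    polynomials, and evaluating them takes only finite sums. *)
Definition fps2_eval : {poly {poly R}} -> fps R := horner_morph comm_map_poly_at.
HB.instance Definition _ := GRing.RMorphism.on fps2_eval.

(** The term of degree i carries the factor z^i, so it cannot reach the coefficient of z^n when i >
    n. *)
Lemma fps2_eval_coef_eq0 (P : {poly {poly R}}) n :
  (forall i, (i <= n)%N -> P`_i = 0) -> fps2_eval P n = 0.
Proof.
move=> P0; rewrite /fps2_eval /horner_morph horner_coef coef_fps_sum big1 //.
move=> i _; rewrite mulrC coef_fpsXnM; case: ltnP => // le_in.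
by rewrite coef_map P0 // raddf0 /= if_same.
Qed.

Lemma eq_fps2_eval (P S : {poly {poly R}}) n :
  (forall i, (i <= n)%N -> P`_i = S`_i) -> fps2_eval P n = fps2_eval S n.
Proof.
move=> PS; apply/eqP; rewrite -subr_eq0; apply/eqP.
transitivity (fps2_eval (P - S) n); first by rewrite rmorphB.
by apply: fps2_eval_coef_eq0 => i le_in; rewrite coefB PS ?subrr.
Qed.

(* M(z, v(z)), which makes sense for every v: its coefficient of z^n depends on
   M only modulo z^(n+1), so the ring morphism laws follow from those of the
   polynomial evaluation fps2_eval. *)
Definition subst_u M : fps R :=
  FPS (fun n => fps2_eval (fps_trunc n.+1 M) n).

Fact subst_u_is_zmod_morphism : zmod_morphism subst_u.
Proof.
move=> M N; apply/fpsP => n.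
transitivity (fps2_eval (fps_trunc n.+1 M - fps_trunc n.+1 N) n).
  apply: eq_fps2_eval => i le_in.
  by rewrite coefB !fps_trunc_coef.
by rewrite rmorphB.
Qed.

Fact subst_u_is_monoid_morphism : monoid_morphism subst_u.
Proof.
split=> [|M N]; apply/fpsP => n.
  transitivity (fps2_eval 1 n); last by rewrite rmorph1.
  apply: eq_fps2_eval => i le_in.
  by rewrite fps_trunc_coef // coef1; case: i le_in.
transitivity (fps2_eval (fps_trunc n.+1 M * fps_trunc n.+1 N) n).
  apply: eq_fps2_eval => i le_in.
  by rewrite fps_trunc_coef // -fps_trunc_mul.
rewrite rmorphM !coef_fpsM; apply: eq_bigr => i _.
(* Here both factors are truncated at order n+1, in [subst_u] at i+1 and n-i+1; they agree up to the
   coefficient read. *)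
congr (_ * _); apply: eq_fps2_eval => j le_ji; rewrite !fps_trunc_coef //.
  by rewrite (leq_ltn_trans le_ji).
by rewrite (leq_ltn_trans le_ji) // ltnS leq_subr.
Qed.

HB.instance Definition _ :=
  GRing.isZmodMorphism.Build (fps {poly R}) (fps R) subst_u
    subst_u_is_zmod_morphism.
HB.instance Definition _ :=
  GRing.isMonoidMorphism.Build (fps {poly R}) (fps R) subst_u
    subst_u_is_monoid_morphism.

Lemma subst_u_fpsC P : subst_u (fpsC P) = (map_poly (@fpsC R) P).[v].
Proof.
apply/fpsP => n; transitivity (fps2_eval P%:P n).
  apply: eq_fps2_eval => i le_in.
  by rewrite fps_trunc_coef // coefC.
by rewrite /fps2_eval horner_morphC.
Qed.

Lemma subst_u_fpsX : subst_u fpsX = fpsX.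
Proof.
apply/fpsP => n; transitivity (fps2_eval 'X n).
  apply: eq_fps2_eval => i le_in.
  by rewrite fps_trunc_coef // coefX.
by rewrite /fps2_eval horner_morphX.
Qed.

Lemma subst_u_map_polyC (f : fps R) : subst_u (fps_map polyC f) = f.
Proof.
apply/fpsP => n.
rewrite /= /fps2_eval /horner_morph (@horner_coef_wide _ n.+1); last first.
  by rewrite (leq_trans (size_poly _ _)) ?size_poly.
(* Only the last term matters: a constant times z^i with i < n contributes nothing to z^n. *)
rewrite coef_fps_sum big_ord_recr big1 => [|i _].
  rewrite [LHS]add0r mulrC coef_fpsXnM ltnn subnn coef_map fps_trunc_coef //.
  by rewrite /= poly_atC.
rewrite mulrC coef_fpsXnM ltnNge (ltnW (ltn_ord i)) /= coef_map.
rewrite fps_trunc_coef ?(ltn_trans (ltn_ord i)) // /= poly_atC /=.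
by rewrite subn_eq0 leqNgt ltn_ord.
Qed.

End Substitution.

(** * Differentiation in u, and the algebra of the kernel *)

Section FpsDeriv.
Variable R : comNzRingType.
Implicit Types M N : fps {poly R}.

Definition deriv_u M : fps {poly R} := fps_map (@deriv R) M.

Lemma deriv_uD : {morph deriv_u : M N / M + N}.
Proof. by move=> M N; apply/fpsP => n; rewrite /= derivD. Qed.

Lemma deriv_uN : {morph deriv_u : M / - M}.
Proof. by move=> M; apply/fpsP => n; rewrite /= derivN. Qed.

Lemma deriv_uM M N : deriv_u (M * N) = deriv_u M * N + M * deriv_u N.
Proof.
apply/fpsP => n; rewrite /= raddf_sum -big_split; apply: eq_bigr => i _ /=.
exact: derivM.
Qed.

Lemma deriv_u_fpsC P : deriv_u (fpsC P) = fpsC P^`().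
Proof. by apply/fpsP => -[|n] //=; rewrite deriv0. Qed.

Lemma deriv_u_fpsX : deriv_u fpsX = 0.
Proof.
by apply/fpsP => -[|[|n]] /=; rewrite ?derivC // -?[1]/(1%:P) ?deriv0 ?derivC.
Qed.

Lemma deriv_u_map_polyC (f : fps R) : deriv_u (fps_map polyC f) = 0.
Proof. by apply/fpsP => n; rewrite /= derivC if_same. Qed.

End FpsDeriv.

(* The coefficient of [d] in [w1E] is the kernel [v - x v p0' - x p1'], which
   [vE] reduces to the differences [p0 - p0'] and [p1 - p1']. *)
Lemma w_discrepancy (A : comNzRingType)
    (x v w w1 d G a p0 p1 q p0' p1' q' g0 k0 g1 k1 gu ku : A) :
    v = x * v * p0 + x * p1 -> w = G + x * q + x * w * p0 ->
    d * v + w1 = G + x * (p0' * (d * v + w1) + p1' * d + q') ->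
    p0 - p0' = g0 * a + k0 * (w - w1) -> p1 - p1' = g1 * a + k1 * (w - w1) ->
    q - q' = gu * a + ku * (w - w1) ->
  w - w1 = x * ((gu + w1 * g0 + d * (v * g0 + g1)) * a
              + (ku + w1 * k0 + d * (v * k0 + k1) + p0) * (w - w1)).
Proof.
move=> vE wE w1E p0E p1E qE.
transitivity (x * ((q - q') + w1 * (p0 - p0')
    + d * (v * (p0 - p0') + (p1 - p1')) + p0 * (w - w1))); last first.
  by rewrite qE p0E p1E; ring.
have vE0 : v - (x * v * p0 + x * p1) = 0 by rewrite -vE subrr.
have wE0 : w - (G + x * q + x * w * p0) = 0 by rewrite -wE subrr.
have w1E0 : d * v + w1 - (G + x * (p0' * (d * v + w1) + p1' * d + q')) = 0.
  by rewrite -w1E subrr.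
(* The identity is [d] times the equation of [v], plus that of [w], minus that of [w1]; the terms
   [d * v] and [G] cancel. *)
apply: subr0_eq; rewrite -[RHS](mulr0 d) -vE0 -[RHS]addr0 -wE0.
by rewrite -[RHS]subr0 -w1E0; ring.
Qed.

(** * Comparison with the system, and the formula for M(z,0) *)

Lemma catalytic_char_eq (R : realFieldType) (F0 : {poly R}) (Q : {mpoly R[4]})
    (M : fps {poly R}) (f v w : fps R) :
    catalytic_eq F0 Q M -> char_system F0 Q f v w ->
  subst_u v M = f /\ subst_u v (diff_quot M) = w.
Proof.
move=> M_sol [fE vE wE].
(* Presents the scalar embedding of [catalytic_eq] as a ring morphism, as the evaluation lemmas
   require. *)
pose h : {rmorphism R -> fps {poly R}} := @fpsC {poly R} \o @polyC R.
pose D := diff_quot M; pose D' := deriv_u D.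
pose E P := eval4 h P M D fpsX (fpsC 'X).
have X'E : deriv_u (fpsC 'X) = 1 :> fps {poly R} by rewrite deriv_u_fpsC derivX.
have ME : M = fpsC F0 + fpsX * E Q by exact: M_sol.
have M'E : deriv_u M = fpsC F0^`()
    + fpsX * (E Q^`M(i_a0) * deriv_u M + E Q^`M(i_a1) * D' + E Q^`M(i_u)).
  rewrite {1}ME deriv_uD deriv_u_fpsC deriv_uM deriv_u_fpsX mul0r add0r.
  rewrite (derivation_eval4 (D := @deriv_u R) (h := h)) //.
  - exact: deriv_uD.
  - exact: deriv_uM.
  - move=> c; rewrite /= deriv_u_fpsC derivC; exact: rmorph0.
  - exact: deriv_u_fpsX.
have D'E : deriv_u M = D' * fpsC 'X + D.
  have := congr1 (@deriv_u _) (diff_quotE M).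
  rewrite deriv_uM X'E mulr1 deriv_uD deriv_uN.
  by rewrite deriv_u_map_polyC subr0.
pose f1 := subst_u v M; pose w1 := subst_u v D; pose d1 := subst_u v D'.
have EE P : subst_u v (E P) = eval_fps P f1 w1 v.
  rewrite /E rmorph_eval4 /= subst_u_fpsX subst_u_fpsC map_polyX hornerX.
  (* Substitution fixes scalars, so the composed embedding is [fpsC] again. *)
  congr eval4; apply: funext => c /=.
  by rewrite subst_u_fpsC map_polyC hornerC.
have substE P N :
    subst_u v (fpsC P + fpsX * N) = horner_fps P v + fpsX * subst_u v N.
  by rewrite rmorphD rmorphM /= subst_u_fpsC subst_u_fpsX.
have f1E : f1 = horner_fps F0 v + fpsX * eval_fps Q f1 w1 v.
  by rewrite -EE -substE -ME.
have w1E : d1 * v + w1 = horner_fps F0^`() v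
    + fpsX * (eval_fps Q^`M(i_a0) f1 w1 v * (d1 * v + w1)
              + eval_fps Q^`M(i_a1) f1 w1 v * d1 + eval_fps Q^`M(i_u) f1 w1 v).
  have vX : v = subst_u v (fpsC 'X) by rewrite subst_u_fpsC map_polyX hornerX.
  have -> : d1 * v + w1 = subst_u v (deriv_u M).
    by rewrite D'E rmorphD rmorphM /= -vX.
  rewrite {1}M'E substE -!EE.
  move: (E _) (E _) (E _) => E0 E1 Eu.
  by rewrite !rmorphD !rmorphM.
(* Puts the differences of Q and its three derivatives into the ideal of [f - f1] and [w - w1]. *)
have [[g h0] /= gE] := eval4_sub (@fpsC R) Q f w f1 w1 fpsX v.
have [[g0 k0] /= g0E] := eval4_sub (@fpsC R) Q^`M(i_a0) f w f1 w1 fpsX v.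
have [[g1 k1] /= g1E] := eval4_sub (@fpsC R) Q^`M(i_a1) f w f1 w1 fpsX v.
have [[gu ku] /= guE] := eval4_sub (@fpsC R) Q^`M(i_u) f w f1 w1 fpsX v.
rewrite -!/(eval_fps _ _ _ _) in gE g0E g1E guE.
(* The first row of coefficients comes from the two equations for f, the second from
   [w_discrepancy]. *)
have [] := @linear_contraction_eq0 _ g h0
   (gu + w1 * g0 + d1 * (v * g0 + g1))
   (ku + w1 * k0 + d1 * (v * k0 + k1) + eval_fps Q^`M(i_a0) f w v)
   (f - f1) (w - w1).
- by rewrite -gE mulrBr {1}fE {1}f1E opprD addrACA subrr add0r.
- exact: (w_discrepancy vE wE w1E g0E g1E guE).
by move=> /subr0_eq -> /subr0_eq ->.
Qed.

Theorem proposition2 (R : realFieldType)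
  (F0 : {poly R}) (Q : {mpoly R[4]})
  (F0_ge0 : forall i : nat, 0 <= F0`_i)
  (Q_ge0 : forall m : 'X_{1..4}, 0 <= Q@_m)
  (Q_a1 : Q^`M(i_a1) != 0)
  (M : fps {poly R}) (M_sol : catalytic_eq F0 Q M)
  (Q_nonlinear : [\/ Q^`M(i_a0)^`M(i_a0) != 0,
                     Q^`M(i_a0)^`M(i_a1) != 0
                   | Q^`M(i_a1)^`M(i_a1) != 0])
  (f u w : fps R) (fuw_sol : char_system F0 Q f u w)
  (f_init : f 0%N = F0.[0])
  (u_init : u 0%N = 0)
  (w_init : w 0%N = F0^`().[0]) :
  at_u0 M = f - w * u.
Proof.
have [<- <-] := catalytic_char_eq M_sol fuw_sol.
(* Since M(z,0) is free of u, substitution fixes it, and the defining relation of D becomes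
   D(z,u(z)) u(z) = M(z,u(z)) - M(z,0). *)
have /(congr1 (subst_u u)) := diff_quotE M.
rewrite rmorphM rmorphB /= subst_u_map_polyC subst_u_fpsC map_polyX hornerX.
by move=> ->; rewrite opprB addrC subrK.
Qed.
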